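(* Let $(\Sigma, I, \to, \preceq)$ be a well-structured transition system and let $P \subseteq \Sigma$ be a downward-closed set. If the rule system described in the context admits a derivation $\mathsf{Init} \mapsto^{*} \mathsf{invalid}$, then $\mathrm{Cover} \not\subseteq P$.
   Context: A well-structured transition system (WSTS) $(\Sigma, I, \to, \preceq)$ consists of a set $\Sigma$ of states, a finite set $I \subseteq \Sigma$ of initial states, a relation $\to \subseteq \Sigma \times \Sigma$, and a well-quasi-order $\preceq$ on $\Sigma$ such that whenever $s_1 \to s_2$ and $s_1 \preceq t_1$, there is $t_2$ with $t_1 \to^{*} t_2$ and $s_2 \preceq t_2$. For $Y \subseteq \Sigma$, $\uparrow Y = \{x \mid \exists y \in Y,\ y \preceq x\}$ and $\downarrow Y = \{x \mid \exists y \in Y,\ x \preceq y\}$; $\uparrow x = \uparrow\{x\}$. For $X \subseteq \Sigma$, $\mathrm{pre}(X) = \{y \mid \exists x \in X,\ y \to x\}$. $\mathrm{Reach}$ is the set of states reachable from $I$ via $\to^{*}$, and $\mathrm{Cover} = \downarrow \mathrm{Reach}$. The rule system (generic version). Its states are $\mathsf{Init}$, $\mathsf{valid}$, $\mathsf{invalid}$, and pairs $\mathbf{R} \mid Q$ where $\mathbf{R} = (R_0, \ldots, R_N)$ ($N \ge 0$, called the length) is a vector of downward-closed subsets of $\Sigma$ and $Q$ is a finite priority queue of pairs $\langle a, i\rangle \in \Sigma \times \mathbb{N}$ with priority $i$; $\min Q$ is an element of least priority, $\mathrm{popMin}(Q)$ is $Q$ with that element removed, $\mathrm{push}(Q,x)$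 is $Q$ with $x$ added. For $0 \le i \le N$ and $a \in \Sigma$ let $\mathrm{Gen}_i(a) = \{ b \mid b \preceq a,\ \uparrow b \cap I = \emptyset,\ \mathrm{pre}(\uparrow b) \cap (R_i \setminus \uparrow b) = \emptyset\}$. $\mathbf{R}[R_k \gets R'_k]_{k=1}^i$ denotes $(R_0, R'_1, \ldots, R'_i, R_{i+1}, \ldots, R_N)$. The one-step relation $\mapsto$ is given by the rules: (Initialize) $\mathsf{Init} \mapsto (\downarrow I) \mid \emptyset$ (a vector of length $0$ with $R_0 = \downarrow I$). (CandidateNondet) if $a \in R_N \setminus P$: $\mathbf{R} \mid \emptyset \mapsto \mathbf{R} \mid \{\langle a, N\rangle\}$. (ModelSyn) if $\min Q = \langle a, 0\rangle$: $\mathbf{R}\mid Q \mapsto \mathsf{invalid}$. (ModelSem) if $\min Q = \langle a, i\rangle$ and $I \cap \uparrow a \neq \emptyset$: $\mathbf{R}\mid Q \mapsto \mathsf{invalid}$. (DecideNondet) if $\min Q = \langle a, i \rangle$, $i > 0$, $b \in \mathrm{pre}(\uparrow a) \cap (R_{i-1} \setminus \uparrow a)$: $\mathbf{R}\mid Q \mapsto \mathbf{R} \mid \mathrm{push}(Q, \langle b, i-1\rangle)$. (Conflict) if $\min Q = \langle a, i\rangle$, $i>0$, $\mathrm{pre}(\uparrow a) \cap (R_{i-1}\setminus \uparrow a) = \emptyset$ and $b \in \mathrm{Gen}_{i-1}(a)$: $\mathbf{R}\mid Q \mapsto \mathbf{R}[R_k \gets R_k \setminus \uparrow b]_{k=1}^{i}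 \mid \mathrm{popMin}(Q)$. (Induction) if $R_i = \Sigma \setminus \uparrow\{r_{i,1}, \ldots, r_{i,m}\}$ and $b \in \mathrm{Gen}_i(r_{i,j})$ for some $1 \le j \le m$: $\mathbf{R} \mid \emptyset \mapsto \mathbf{R}[R_k \gets R_k \setminus \uparrow b]_{k=1}^{i+1} \mid \emptyset$. (Valid) if $R_i = R_{i+1}$ for some $i < N$: $\mathbf{R}\mid Q \mapsto \mathsf{valid}$. (Unfold) if $R_N \subseteq P$: $\mathbf{R} \mid \emptyset \mapsto (R_0, \ldots, R_N, \Sigma) \mid \emptyset$. $\mapsto^{*}$ is the reflexive-transitive closure of $\mapsto$. *)

(* Defs.v *)
From Stdlib Require List Relation_Definitions Relation_Operators.
From mathcomp Require Import all_boot.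
From mathcomp Require Import boolp classical_sets cardinality.

Set Implicit Arguments.
Unset Strict Implicit.
Unset Printing Implicit Defensive.

Local Open Scope classical_set_scope.

Notation star := Relation_Operators.clos_refl_trans.

Definition well_quasi_order (T : Type) (le : T -> T -> Prop) : Prop :=
  Relation_Definitions.preorder T le /\
  forall f : nat -> T, exists i j : nat, (i < j)%N /\ le (f i) (f j).

Record wsts := Wsts {
  state :> Type;
  initial : set state;
  trans : state -> state -> Prop;
  below : state -> state -> Prop;
  initial_finite : finite_set initial;
  below_wqo : well_quasi_order below;
  trans_compat : forall s1 s2 t1 : state, trans s1 s2 -> below s1 t1 ->
    exists t2 : state, star _ trans t1 t2 /\ below s2 t2
}.

Arguments initial : clear implicits.

Section WSTS.
Variable S : wsts.
Implicit Types (X Y : set S) (a b : S).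

Definition upward Y : set S := [set x | exists2 y, Y y & below y x].
Definition downward Y : set S := [set x | exists2 y, Y y & below x y].
Definition pre X : set S := [set y | exists2 x, X x & trans y x].

Definition downward_closed X : Prop :=
  forall x y, below x y -> X y -> X x.

Definition Reach : set S :=
  [set y | exists2 x, initial S x & star _ (@trans S) x y].
Definition Cover : set S := downward Reach.

Record downset := Downset {
  downset_set :> set S;
  downset_closed : downward_closed downset_set
}.

Lemma below_trans a b c : below a b -> below b c -> below a c.
Proof. by case: (below_wqo S) => -[_ tr] _; apply: tr. Qed.

Lemma downward_is_closed Y : downward_closed (downward Y).
Proof. by move=> x y xy [z Yz yz]; exists z => //; apply: below_trans yz. Qed.

Lemma setD_upward_closed (D : downset) Y : downward_closed (D `\` upward Y).
Proof.
move=> x y xy [Dy nUy]; split; first exact: downset_closed Dy.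
by move=> [z Yz zx]; apply: nUy; exists z => //; apply: below_trans xy.
Qed.

Lemma setT_closed : downward_closed [set: S].
Proof. by []. Qed.

Definition downward_initial : downset := Downset (@downward_is_closed (initial S)).
Definition full_downset : downset := Downset setT_closed.
Definition downset_minus (D : downset) b : downset :=
  Downset (@setD_upward_closed D [set b]).

(* R[R_k <- R_k \ upward {b}]_{k=1}^i; the component R_0 is never modified *)
Definition strengthen (N : nat) (R : N.+1.-tuple downset) (b : S) (i : nat) :
    N.+1.-tuple downset :=
  [tuple if (1 <= k <= i)%N then downset_minus (tnth R k) b else tnth R k
     | k < N.+1].

(* Gen_i(a) is [Gen R_i a] *)
Definition Gen (F : set S) a : set S :=
  [set b | [/\ below b a, upward [set b] `&` initial S = set0 &
               pre (upward [set b]) `&` (F `\` upward [set b]) = set0]].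

(* A finite priority queue is the list of its entries; the order of the list
   carries no information, since min Q may be any entry of least priority,
   wherever it occurs (ties are broken arbitrarily). *)
Definition queue := seq (S * nat).

Definition push (Q : queue) (x : S * nat) : queue := x :: Q.

Definition isMin (Q : queue) (x : S * nat) : Prop :=
  List.In x Q /\ forall y, List.In y Q -> (x.2 <= y.2)%N.

(* [popMin Q x Q']: x serves as min Q, and Q' is Q with one occurrence of x
   removed *)
Definition popMin (Q : queue) (x : S * nat) (Q' : queue) : Prop :=
  isMin Q x /\ exists Q1 Q2 : queue, Q = Q1 ++ x :: Q2 /\ Q' = Q1 ++ Q2.

Inductive config :=
| Init
| Valid
| Invalid
| Frames (N : nat) (R : N.+1.-tuple downset) (Q : queue).

(* Frame indices are ordinals in 'I_N.+1, so a rule that mentions R_i applies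
   only when i <= N; in particular Induction at i requires i + 1 <= N. *)
Inductive step (P : set S) : config -> config -> Prop :=
| Initialize :
    step P Init (Frames [tuple downward_initial] [::])
| CandidateNondet (N : nat) (R : N.+1.-tuple downset) (a : S) :
    (tnth R ord_max `\` P) a ->
    step P (Frames R [::]) (Frames R (push [::] (a, N)))
| ModelSyn (N : nat) (R : N.+1.-tuple downset) (Q : queue) (a : S) :
    isMin Q (a, 0%N) ->
    step P (Frames R Q) Invalid
| ModelSem (N : nat) (R : N.+1.-tuple downset) (Q : queue) (a : S) (i : nat) :
    isMin Q (a, i) ->
    initial S `&` upward [set a] !=set0 ->
    step P (Frames R Q) Invalid
| DecideNondet (N : nat) (R : N.+1.-tuple downset) (Q : queue) (a b : S)
    (i : nat) (j : 'I_N.+1) :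
    isMin Q (a, i) -> i = j.+1 ->
    (pre (upward [set a]) `&` (tnth R j `\` upward [set a])) b ->
    step P (Frames R Q) (Frames R (push Q (b, j : nat)))
| Conflict (N : nat) (R : N.+1.-tuple downset) (Q Q' : queue) (a b : S)
    (i j : 'I_N.+1) :
    popMin Q (a, i : nat) Q' -> i = j.+1 :> nat ->
    pre (upward [set a]) `&` (tnth R j `\` upward [set a]) = set0 ->
    Gen (tnth R j) a b ->
    step P (Frames R Q) (Frames (strengthen R b i) Q')
| Induction (N : nat) (R : N.+1.-tuple downset) (i i' : 'I_N.+1)
    (m : nat) (r : 'I_m -> S) (j : 'I_m) (b : S) :
    i' = i.+1 :> nat ->
    tnth R i = ~` upward (range r) :> set S ->
    Gen (tnth R i) (r j) b ->
    step P (Frames R [::]) (Frames (strengthen R b i') [::])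
| ValidRule (N : nat) (R : N.+1.-tuple downset) (Q : queue) (i i' : 'I_N.+1) :
    i' = i.+1 :> nat ->
    tnth R i = tnth R i' :> set S ->
    step P (Frames R Q) Valid
| Unfold (N : nat) (R : N.+1.-tuple downset) :
    tnth R ord_max `<=` P ->
    step P (Frames R [::]) (Frames [tuple of rcons R full_downset] [::]).

End WSTS.

Arguments Init {S}.
Arguments Valid {S}.
Arguments Invalid {S}.

Arguments Reach S : clear implicits.
Arguments Cover S : clear implicits.

(* Main.v *)
Require Import Defs.
From Stdlib Require List Relation_Operators.
From mathcomp Require Import all_boot.
From mathcomp Require Import boolp classical_sets cardinality.

Local Open Scope classical_set_scope.

(** Every state in the queue can reach the complement of [P], and those at
    level [0] lie below an initial state because [R_0] is never modified.  By
    compatibility and downward closure of [P], being able to leave [P] is an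
    upward-closed property, so either rule leading to [Invalid] yields an
    initial state from which the complement of [P] is reachable. *)

Definition escapes {S : wsts} (P : set S) (a : S) : Prop :=
  exists2 y, star _ (@trans S) a y & ~ P y.

(** Compatibility answers a single step with a whole run, so induction on the closure concatenates
    the answering runs. *)
Lemma star_compat {S : wsts} {s s' t : S} :
  star _ (@trans S) s s' -> below s t ->
  exists2 t', star _ (@trans S) t t' & below s' t'.
Proof.
move=> ss'; elim: ss' t => {s s'} [s s' ss'|s|s u s' _ IH1 _ IH2] t st.
- by have [t' [? ?]] := trans_compat ss' st; exists t'.
- by exists t => //; apply: Relation_Operators.rt_refl.
- have [v tv uv] := IH1 _ st; have [t' vt' s't'] := IH2 _ uv.
  by exists t' => //; apply: Relation_Operators.rt_trans vt'.
Qed.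

Lemma escapes_upward {S : wsts} {P : set S} {a t : S} :
  downward_closed P -> escapes P a -> below a t -> escapes P t.
Proof.
move=> P_closed [y ay nPy] leat; have [t' tt' leyt'] := star_compat ay leat.
by exists t' => // Pt'; apply: nPy; apply: P_closed Pt'.
Qed.

(** This preserves the invariant under [DecideNondet]: [b] steps to a state above [a], which escapes
    as [a] does. *)
Lemma escapes_pre {S : wsts} {P : set S} {a b : S} :
  downward_closed P -> escapes P a -> pre (upward [set a]) b -> escapes P b.
Proof.
move=> P_closed esc_a [x [_ -> leax] bx].
have [y xy nPy] := escapes_upward P_closed esc_a leax.
exists y => //; apply: Relation_Operators.rt_trans xy.
exact: Relation_Operators.rt_step.
Qed.

(** The second conjunct serves [ModelSyn], which answers [Invalid] at level [0] without testing the
    entry against the initial states. *)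
Definition entry_ok {S : wsts} (P : set S) (e : S * nat) : Prop :=
  escapes P e.1 /\ (e.2 = 0%N -> downward (initial S) e.1).

Definition config_ok {S : wsts} (P : set S) (c : config S) : Prop :=
  match c with
  | Init | Valid => True
  | Invalid => exists2 x, initial S x & escapes P x
  | Frames N R Q => tnth R ord0 = downward_initial S /\
                    forall e, List.In e Q -> entry_ok P e
  end.

Lemma strengthen_ord0 {S : wsts} {N : nat} (R : N.+1.-tuple (downset S))
    (b : S) (i : nat) :
  tnth (strengthen R b i) ord0 = tnth R ord0.
Proof. by rewrite tnth_mktuple. Qed.

Lemma In_popMin {S : wsts} {Q Q' : queue S} {x e : S * nat} :
  popMin Q x Q' -> List.In e Q' -> List.In e Q.
Proof.
move=> [_ [Q1 [Q2 [-> ->]]]]; elim: Q1 => [|y Q1 IH] /=; first by right.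
by case=> [->|/IH]; [left | right].
Qed.

Lemma config_ok_step {S : wsts} {P : set S} {c c' : config S} :
  downward_closed P -> step P c c' -> config_ok P c -> config_ok P c'.
Proof.
move=> P_closed; case=> {c c'} //=.
- move=> N R a [Ra nPa] [R0 _]; split=> // e [<-|//]; split=> /=.
    by exists a => //; apply: Relation_Operators.rt_refl.
  (* A candidate has level [0] only when [N = 0], and then the last frame is [R_0]. *)
  move=> N0; move: Ra; suff -> : ord_max = ord0 :> 'I_N.+1 by rewrite R0.
  exact: val_inj.
- move=> N R Q a [Qa _] [_ /(_ _ Qa)[esc_a /(_ erefl)[x Ix leax]]].
  by exists x => //; apply: escapes_upward leax.
- move=> N R Q a i [Qa _] [x [Ix [_ -> leax]]] [_ /(_ _ Qa)[esc_a _]].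
  by exists x => //; apply: escapes_upward leax.
- move=> N R Q a b i j [Qa _] _ [pre_b [Rb _]] [R0 okQ].
  split=> // e [<-|/okQ //]; split=> /=.
    by apply: escapes_pre pre_b => //; case: (okQ _ Qa).
  move=> j0; move: Rb; suff -> : j = ord0 by rewrite R0.
  exact: val_inj.
- move=> N R Q Q' a b i j pop _ _ _ [R0 okQ].
  by rewrite strengthen_ord0; split=> // e /(In_popMin pop) /okQ.
- by move=> N R i i' m r j b _ _ _ [R0 okQ]; rewrite strengthen_ord0.
- move=> N R _ [R0 _]; split=> //; move: R0.
  (* The old vector is nonempty, so index [0] of the [rcons] still reads from it, never the appended
     frame or the default. *)
  by rewrite !(tnth_nth (full_downset S)) /= nth_rcons size_tuple.
Qed.

Theorem theorem2 (S : wsts) (P : set S) (P_closed : downward_closed P) :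
  star _ (step P) Init Invalid -> ~ (Cover S `<=` P).
Proof.
move=> der CoverP.
have ok c c' : star _ (step P) c c' -> config_ok P c -> config_ok P c'.
  elim=> {c c'} [c c' /config_ok_step|//|c d c' _ IH1 _ IH2 /IH1 /IH2 //].
  exact.
have [x Ix [y xy nPy]] := ok _ _ der Logic.I.
(* [y] is itself reachable, so reflexivity of [below] places it in [Cover]. *)
apply: nPy; apply: CoverP; exists y; first by exists x.
by case: (below_wqo S) => -[refl _] _; apply: refl.
Qed.
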